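(* Let $N$ be even, $L=N/2$, and let $(g_\lambda,E_\lambda,M_\lambda)_{\lambda\in\Lambda}$ be a painless finite system of bands on $\mathbb{R}^N$ with analysis operator $T$, synthesis operator $S$ and maximal fan-out $D$, all as defined in the context. Let $r\ge 2$ be an integer such that $L$ and every $M_\lambda$ ($\lambda\in\Lambda$) can be written as a product of integers between $2$ and $r$. Then each of the maps $T$ (analysis) and $S$ (synthesis) can be evaluated, in the layered model described in the context, with depth at most $$d=\tau_r(L)+1+\max_{\lambda\in\Lambda}\tau_r(M_\lambda)$$ and real block width at most $$w=\max\{2r,\,4,\,2D\}.$$ Here $\tau_r(n)$ denotes the least number $d'$ of factors in a product $n=r_1\cdots r_{d'}$ with integers $2\le r_j\le r$.
   Context: **Fourier matrices.** $F_n\in\mathbb{C}^{n\times n}$ has entries $[F_n]_{kj}=e^{-2\pi i kj/n}$, $0\le k,j\le n-1$, and $F_n^{-1}=\frac1n F_n^H$. **Bands.** $N$ is even and $\Lambda$ is a finite index set. Each band $\lambda\in\Lambda$ has a length $M_\lambda$, a real spectral window $g_\lambda=(g_{\lambda,k})_{0\le k<N}\in\mathbb{R}^N$, and a selection matrix $E_\lambda\in\mathbb{R}^{M_\lambda\times N}$ with entries in $\{0,1\}$, which places the bins $k$ with $g_{\lambda,k}\neq 0$ into distinct slots $m\in\{0,\dots,M_\lambda-1\}$. That is, there is an injective map $\sigma_\lambda$ from $\{k: g_{\lambda,k}\ne0\}$ to $\{0,\dots,M_\lambda-1\}$ with $[E_\lambda]_{m,k}=1$ if $g_{\lambda,k}\neq0$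 and $m=\sigma_\lambda(k)$, and $[E_\lambda]_{m,k}=0$ otherwise. If $m=\sigma_\lambda(k)$, one says that entry $m$ of band $\lambda$ holds bin $k$. The system is painless: for every $\lambda\in\Lambda$ the map $\sigma_\lambda:\{k: g_{\lambda,k}\ne0\}\to\{0,\dots,M_\lambda-1\}$ is injective, and every bin is covered, meaning $a_k:=\sum_\lambda M_\lambda g_{\lambda,k}^2>0$ for $0\le k\le N/2$. **Analysis.** $T:\mathbb{R}^N\to\prod_\lambda\mathbb{C}^{M_\lambda}$ is $Tx=\{c_\lambda\}_\lambda$ with $c_\lambda=F_{M_\lambda}^{-1}u_\lambda$ and $u_\lambda=E_\lambda\,\mathrm{diag}(g_\lambda)F_Nx$. **Synthesis.** Let $h_{\lambda,k}=M_\lambda g_{\lambda,k}/a_k$ for $0\le k\le N/2$. $S:\prod_\lambda\mathbb{C}^{M_\lambda}\to\mathbb{R}^N$ is defined as follows. Form $Y_k=\sum_\lambda h_{\lambda,k}[E_\lambda^\top F_{M_\lambda}c_\lambda]_k$ for $0\le k\le N/2$, replace $Y_0$ and $Y_{N/2}$ by their real parts, set $Y_{N-k}=\overline{Y_k}$ for $1\le k<N/2$, and put $S(\{c_\lambda\}_\lambda)=F_N^{-1}Y$. **Fan-out.** Let $L=N/2$. For $q\in\mathbb{Z}/L$, the fan-out $D_q$ of the unordered pair $\{q,-q\}\subset\mathbb{Z}/L$ is the number of pairs $(\lambda,m)$, over all bands, such that entry $m$ of band $\lambda$ holds a bin $k$ (so $g_{\lambda,k}\ne0$) with $k\bmod L\in\{q,-q\}$.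 Put $D=\max_q D_q$. **Layered model.** Complex vectors are regarded as real vectors of twice the length (real and imaginary parts). A layer is a real-linear map that splits into independent real-linear blocks. Each block reads its own group of input coordinates and writes its own group of output coordinates; groups belonging to different blocks are disjoint, and coordinates in a group need not be consecutive. The width of a block is the larger of its real input and output dimensions. Between layers, free wiring may reorder entries, change signs or insert zeros, but may not duplicate entries. A linear map is evaluated with depth at most $d$ and real block width at most $w$ if it equals a composition of at most $d$ layers, interleaved with such wiring, all of whose blocks have width at most $w$. *)

(* Defs.v *)
From HB Require Import structures.
From mathcomp Require Import all_boot all_order all_algebra.
From mathcomp Require Import fingroup perm complex zify ring.
From mathcomp Require Import boolp reals trigo.

Set Implicit Arguments.
Unset Strict Implicit.
Unset Printing Implicit Defensive.
Import Order.TTheory GRing.Theory Num.Theory.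
Local Open Scope ring_scope.
Local Open Scope complex_scope.

(* e^(i t) *)
Definition cis (R : realType) (t : R) : R[i] := cos t +i* sin t.

Lemma cis_periodicn (R : realType) (t : R) (n : nat) : cis (t - 2 * pi * n%:R) = cis t.
Proof.
elim: n => [|n IH]; first by rewrite mulr0 subr0.
have -> : t - 2 * pi * n.+1%:R = t - 2 * pi * n%:R - pi *+ 2.
  by rewrite -[n.+1%:R]natr1 mulrDr mulr1 opprD addrA mulr_natl.
by rewrite -IH /cis -[in RHS](subrK (pi *+ 2) (t - _)) cosD2pi sinD2pi.
Qed.

Definition fourier (R : realType) (n : nat) : 'M[R[i]]_n :=
  \matrix_(k, j) cis (- (2 * pi * (k * j)%:R / n%:R)).

Definition mxC (R : realType) (m n : nat) (A : 'M[R]_(m, n)) : 'M[R[i]]_(m, n) :=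
  map_mx (real_complex R) A.

(* [slot] is the map sigma from the support of the window to the entries;
   its injectivity is part of [painless]. *)
Record band (R : realType) (N : nat) := Band {
  blen : nat;
  window : 'rV[R]_N;
  slot : {k : 'I_N | window 0 k != 0} -> 'I_blen
}.

Section Bands.
Variables (R : realType) (N : nat).

Definition holds (b : band R N) (m : 'I_(blen b)) (k : 'I_N) : bool :=
  [exists k' : {k : 'I_N | window b 0 k != 0}, (val k' == k) && (slot k' == m)].

Definition selmx (b : band R N) : 'M[R]_(blen b, N) :=
  \matrix_(m, k) (holds m k)%:R.

Variables (Lam : finType) (b : Lam -> band R N).

Definition coverage (k : 'I_N) : R :=
  \sum_l (blen (b l))%:R * window (b l) 0 k ^+ 2.

Definition painless : Prop :=
  (forall l, injective (@slot R N (b l))) /\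
  (forall k : 'I_N, (k <= N./2)%N -> 0 < coverage k).

Definition coeffs := forall l, 'cV[R[i]]_(blen (b l)).

Definition analysis (x : 'cV[R]_N) : coeffs := fun l =>
  invmx (fourier R (blen (b l))) *m
    (mxC (selmx (b l)) *m mxC (diag_mx (window (b l))) *m fourier R N *m mxC x).

Definition dual_window (l : Lam) (k : 'I_N) : R :=
  (blen (b l))%:R * window (b l) 0 k / coverage k.

(* Y_k; only used for k <= N/2. *)
Definition half_spectrum (c : coeffs) (k : 'I_N) : R[i] :=
  \sum_l (dual_window l k)%:C *
    ((mxC (selmx (b l)))^T *m (fourier R (blen (b l)) *m c l)) k 0.

Lemma neg_ord_subproof (k : 'I_N) : ((N - k) %% N < N)%N.
Proof. by rewrite ltn_pmod //; apply: leq_ltn_trans (ltn_ord k). Qed.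

(* The bin -k modulo N. *)
Definition neg_ord (k : 'I_N) : 'I_N := Ordinal (neg_ord_subproof k).

Lemma neg_ordK : involutive neg_ord.
Proof.
move=> k; apply: val_inj => /=; have kN := ltn_ord k.
case: (posnP k) => [->|k0]; first by rewrite subn0 modnn subn0 modnn.
by rewrite (@modn_small (N - k)) ?subKn ?modn_small//; lia.
Qed.

Lemma conj_fourier (k j : 'I_N) :
  conjc (fourier R N k j) = fourier R N (neg_ord k) j.
Proof.
rewrite !mxE /= /cis /= !cosN !sinN opprK.
have kN := ltn_ord k; case: (posnP k) => [->|k0].
  by rewrite subn0 modnn mul0n mulr0 mul0r cos0 sin0 oppr0.
rewrite modn_small; last by lia.
have N0 : N%:R != 0 :> R by rewrite pnatr_eq0; lia.
rewrite mulnBl natrB; last by rewrite leq_mul2r ltnW ?orbT.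
set t := 2 * pi * (k * j)%:R / N%:R.
rewrite (_ : 2 * pi * ((N * j)%:R - (k * j)%:R) / N%:R = - (t - 2 * pi * j%:R)); last first.
  by rewrite /t !natrM; field.
rewrite cosN sinN opprK.
by have := cis_periodicn t j; rewrite /cis => -[-> ->].
Qed.

Definition full_spectrum (c : coeffs) : 'cV[R[i]]_N :=
  \col_k (if (val k == 0%N) || (val k == N./2) then (complex.Re (half_spectrum c k))%:C
          else if (k < N./2)%N then half_spectrum c k
          else conjc (half_spectrum c (neg_ord k))).

(* The entries of the inverse transform are already real when N is even (lemma
   [synthesisE] below), so that taking Re only changes their type. *)
Definition synthesis (c : coeffs) : 'cV[R]_N :=
  map_mx (@complex.Re R) (invmx (fourier R N) *m full_spectrum c).

Lemma conj_full_spectrum (c : coeffs) (k : 'I_N) : ~~ odd N ->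
  conjc (full_spectrum c k 0) = full_spectrum c (neg_ord k) 0.
Proof.
move=> Nev; rewrite !mxE /=; have kN := ltn_ord k.
have NE : (N = N./2 + N./2)%N by rewrite addnn -[LHS]odd_double_half (negbTE Nev).
have [k0|k0] := posnP k.
  rewrite k0 /= subn0 modnn eqxx /= oppr0.
  by have -> : neg_ord k = k by apply: val_inj; rewrite /= k0 subn0 modnn.
rewrite modn_small; last by lia.
have -> : (N - k == 0)%N = false by lia.
rewrite /=; have [kE|kn] := eqVneq (k : nat) N./2.
  have -> /= : (N - k == N./2)%N by lia.
  have -> : neg_ord k = k by apply: val_inj; rewrite /= modn_small; lia.
  by rewrite oppr0.
have -> : (N - k == N./2)%N = false by lia.
case: ltnP => kh.
  have -> : (N - k < N./2)%N = false by lia.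
  by rewrite neg_ordK.
have -> : (N - k < N./2)%N by lia.
by rewrite conjcK.
Qed.

Lemma synthesisE (c : coeffs) : ~~ odd N ->
  mxC (synthesis c) = invmx (fourier R N) *m full_spectrum c.
Proof.
move=> Nev; set F := fourier R N; set Y := full_spectrum c.
pose s := perm (inv_inj neg_ordK); pose P : 'M[R[i]]_N := perm_mx s.
have cF : map_mx conjc F = P *m F.
  by apply/matrixP => k j; rewrite -row_permE [RHS]mxE permE -conj_fourier mxE.
have cY : map_mx conjc Y = P *m Y.
  by apply/matrixP => k j; rewrite -row_permE [RHS]mxE permE ord1 -conj_full_spectrum // mxE.
have Pu : P \in unitmx by rewrite unitmx_perm.
have PP : P *m P = 1%:M.
  rewrite -perm_mxM (_ : (s * s)%g = 1%g) ?perm_mx1 //.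
  by apply/permP => k; rewrite permM !permE neg_ordK.
have FT : F^T = F by apply/matrixP => k j; rewrite !mxE mulnC.
have PFP : P *m F *m P = F.
  have PF : F *m P = P *m F.
    rewrite -cF -[P]trmxK -[in LHS]FT -trmx_mul tr_perm_mx.
    rewrite (_ : s^-1%g = s) -/P; last first.
      apply: (mulgI s); rewrite mulgV; apply/permP => k.
      by rewrite permM !permE neg_ordK.
    by rewrite -cF matrix.map_trmx FT.
  by rewrite -mulmxA PF mulmxA PP mul1mx.
have conjX : map_mx conjc (invmx F *m Y) = invmx F *m Y.
  have [Fu|Fnu] := boolP (F \in unitmx).
    apply: (can_inj (mulKmx Fu)); apply: (can_inj (mulKmx Pu)).
    by rewrite mulmxA -cF -map_mxM !mulKVmx.
  rewrite map_mxM map_invmx cF cY.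
  have PFnu : (P *m F \in unitmx) = false by rewrite unitmx_mul (negbTE Fnu) andbF.
  by rewrite /invmx PFnu (negbTE Fnu) mulmxA PFP.
apply/matrixP => k j; rewrite [LHS]mxE [synthesis c k j]mxE -/F -/Y.
have /matrixP/(_ k j) := conjX; rewrite [LHS]mxE.
case: ((invmx F *m Y) k j) => u v [/eqP]; rewrite eqNr => /eqP ->.
by [].
Qed.

(* Residues q modulo L are represented by q < L; k = -q is written k + q = 0. *)
Definition fan_out_at (q : nat) : nat :=
  #|[set p : {l : Lam & 'I_(blen (b l))} |
      [exists k : 'I_N, holds (tagged p) k &&
        ((k == q %[mod N./2]) || (k + q == 0 %[mod N./2]))%N]]|.

Definition fan_out : nat := \max_(q < N./2) fan_out_at q.

End Bands.

Arguments slot {R N} b _.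
Arguments synthesis {R N Lam} b c.

(* d factors; the empty product gives tau r 1 = 0. *)
Definition is_product (r n d : nat) : Prop :=
  exists s : seq nat, [/\ size s = d, all (fun m => 2 <= m <= r)%N s
                        & (\prod_(m <- s) m)%N = n].

Definition factorable (r n : nat) : Prop := exists d, is_product r n d.

(* [tau r n] is the least d such that [is_product r n d]; it is 0 by convention
   if there is none. *)
Definition tau (r n : nat) : nat :=
  if pselect (exists d, `[< is_product r n d >]) is left ex then ex_minn ex else 0.

(* Real vectors with coordinates indexed by a finite type I. *)
Notation rvec R I := {ffun I -> R^o}.

Section Layered.
Variable R : realType.

(* [inb] and [outb] give the block of each input and output coordinate; a
   coordinate that is ignored (or constantly 0) forms a block of its own. *)
Definition layer (w : nat) (I J : finType) (f : rvec R I -> rvec R J) : Prop :=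
  linear f /\
  exists (B : finType) (inb : I -> B) (outb : J -> B),
    (forall (x y : rvec R I) (j : J),
        (forall i, inb i = outb j -> x i = y i) -> f x j = f y j) /\
    (forall c : B, maxn #|[set i | inb i == c]| #|[set j | outb j == c]| <= w)%N.

(* Every input entry is sent to a place of its own, up to sign, and the other
   places are filled with zeros; entries are neither duplicated nor dropped. *)
Definition wiring (I J : finType) (f : rvec R I -> rvec R J) : Prop :=
  exists (s : I -> J) (e : I -> bool), injective s /\
    forall x : rvec R I,
      (forall i, f x (s i) = (-1) ^+ e i * x i) /\
      (forall j, j \notin codom s -> f x j = 0).

Fixpoint computable (w d : nat) (I J : finType) (f : rvec R I -> rvec R J) : Prop :=
  if d is d'.+1 then
    computable w d' f \/
    exists (K K' : finType) (h : rvec R I -> rvec R K) (g : rvec R K -> rvec R K')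
        (v : rvec R K' -> rvec R J),
      [/\ computable w d' h, layer w g, wiring v & f =1 v \o g \o h]
  else wiring f.

(* F is evaluated through the real coordinates cU of its argument and cV of its
   value. *)
Definition evaluated (d w : nat) (U V : Type) (I J : finType)
    (cU : U -> rvec R I) (cV : V -> rvec R J) (F : U -> V) : Prop :=
  exists f : rvec R I -> rvec R J, computable w d f /\ forall u, f (cU u) = cV (F u).

Definition signal_coords (N : nat) (x : 'cV[R]_N) : rvec R 'I_N := [ffun k => x k 0].

(* The coordinate (l, m, false) is the real part of entry m of c_l, and
   (l, m, true) is its imaginary part. *)
Definition coeff_coords (N : nat) (Lam : finType) (b : Lam -> band R N) (c : coeffs b)
    : rvec R ({l : Lam & 'I_(blen (b l))} * bool)%type :=
  [ffun p => let z := c (tag p.1) (tagged p.1) 0 in if p.2 then complex.Im z else complex.Re z].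

End Layered.

Arguments coeff_coords {R N Lam} b c.

(* Main.v *)
(* Pack the real signal as z_j = x_{2j} + i x_{2j+1} and let w = e^{-2 pi i/N}.
   With Z the transform of z of length L,
     X_k = (1 - i w^k)/2 Z_{k mod L} + (1 + i w^k)/2 conj Z_{-k mod L},
   and, conversely, z_j = sum_q w^{-2qj} Y_q, where
     Y_q = (1/N) sum_{k = q mod L} (1 + i w^{-k}) X_k.
   Hence T is a transform of length L, one layer that couples only the residues
   q and -q with the entries holding a bin k = +-q mod L, and the inverse
   transforms of the bands; S is the same in reverse order. A transform of
   length r_1...r_d takes d layers of complex width max r_j by mixed-radix
   recursion, which works for the powers of any z with z^n = 1, so that forward
   and inverse transforms are the same case. *)
Require Import Defs.
From HB Require Import structures.
From mathcomp Require Import all_boot all_order all_algebra.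
From mathcomp Require Import complex zify ring lra.
From mathcomp Require Import boolp reals trigo.

Set Implicit Arguments.
Unset Strict Implicit.
Unset Printing Implicit Defensive.
Import Order.TTheory GRing.Theory Num.Theory.
Local Open Scope ring_scope.
Local Open Scope complex_scope.

(** * Sizes of blocks in disjoint unions and in pairs of real coordinates *)

Lemma card_fiber_tagged (Lam : finType) (I B : Lam -> finType)
    (f : forall l, I l -> B l) (l : Lam) (c : B l) :
  #|[set p : {l : Lam & I l} | Tagged B (f (tag p) (tagged p)) == Tagged B c]|
    = #|[set i | f l i == c]|.
Proof.
rewrite -(card_imset _ (f := fun i : I l => Tagged I i)) => [|i i' /eqP]; last first.
  by rewrite eq_Tagged => /eqP.
apply: eq_card => -[l' i]; rewrite inE; apply/eqP/imsetP => [/= e|[i']].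
  have ll := congr1 tag e; rewrite /= in ll; case: _ / ll c e => c /eqP.
  by rewrite eq_Tagged /= => e; exists i; rewrite ?inE.
by rewrite inE => /eqP <- ->.
Qed.

Lemma card_fiber_fst (I B : finType) (f : I -> B) (c : B) :
  #|[set p : I * bool | f p.1 == c]| = (2 * #|[set i | f i == c]|)%N.
Proof.
rewrite mulnC -card_bool -cardsT -cardsX; apply: eq_card => -[i e].
by rewrite !inE andbT.
Qed.

(** * Closure properties of layered evaluation *)

Section Calculus.
Variable R : realType.
Implicit Types I J K : finType.

Lemma wiring_ext I J (f g : rvec R I -> rvec R J) : f =1 g -> wiring f -> wiring g.
Proof. by move=> fg [s [e [sI H]]]; exists s, e; split=> // x; rewrite -fg. Qed.

Lemma wiring_comp I J K (f : rvec R I -> rvec R J) (g : rvec R J -> rvec R K) :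
  wiring f -> wiring g -> wiring (g \o f).
Proof.
move=> [s [e [sI H]]] [s' [e' [sI' H']]].
exists (s' \o s), (fun i => e i (+) e' (s i)); split; first exact: inj_comp.
move=> x; have [H1 H2] := H x; have [H1' H2'] := H' (f x); split=> [i|k kn] /=.
  by rewrite H1' H1 mulrA -signr_addb addbC.
have [/codomP[j kE]|/H2' //] := boolP (k \in codom s').
rewrite kE H1' H2 ?mulr0 //; apply: contra kn => /codomP[i jE].
by apply/codomP; exists i; rewrite kE jE.
Qed.

Definition permute I J (t : J -> I) (x : rvec R I) : rvec R J := [ffun j => x (t j)].

Lemma wiring_permute I J (t : J -> I) : bijective t -> wiring (permute t).
Proof.
case=> s ts st; exists s, (fun=> false); split; first exact: can_inj st.
move=> x; split=> [i|j]; first by rewrite ffunE st expr0 mul1r.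
by case/negP; apply/codomP; exists (t j); rewrite ts.
Qed.

Lemma wiring_id I (f : rvec R I -> rvec R I) : f =1 id -> wiring f.
Proof.
move=> fE; have id_bij : bijective (@id I) by exists id.
apply: wiring_ext (wiring_permute id_bij) => x; rewrite fE.
by apply/ffunP => i; rewrite ffunE.
Qed.

(** Serves to pad shallow branches. Each coordinate is a block of its own, hence [0 < w]. *)
Lemma layer_id w I : (0 < w)%N -> layer w (@id (rvec R I)).
Proof.
move=> w0; split=> //; exists I, id, id; split=> [x y j ->//|c].
have -> : [set i | id i == c] = [set c] by apply/setP => i; rewrite !inE.
by rewrite cards1 maxnn.
Qed.

Lemma computable_ext w d I J (f g : rvec R I -> rvec R J) :
  f =1 g -> computable w d f -> computable w d g.
Proof.
elim: d => [|d IH] in J f g * => /= fg; first exact: wiring_ext.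
case=> [H|[K [K' [h [g' [v [H1 H2 H3 H4]]]]]]]; first by left; apply: IH H.
by right; exists K, K', h, g', v; split=> // x; rewrite -fg H4.
Qed.

Lemma computable_leq w d d' I J (f : rvec R I -> rvec R J) :
  (d <= d')%N -> computable w d f -> computable w d' f.
Proof.
move=> /subnK <-; elim: (d' - d)%N => [//|e IH] H; left; exact: IH.
Qed.

Lemma computable_wiring w d I J K (f : rvec R I -> rvec R J) (v : rvec R J -> rvec R K) :
  computable w d f -> wiring v -> computable w d (v \o f).
Proof.
elim: d => [|d IH] in J K f v * => /=; first exact: wiring_comp.
case=> [H|[I1 [I2 [h [g [v' [H1 H2 H3 H4]]]]]]] vW; first by left; apply: IH.
right; exists I1, I2, h, g, (v \o v'); split=> //; first exact: wiring_comp.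
by move=> x /=; rewrite H4.
Qed.

(** The wiring travels down the recursion and merges with the one at depth 0, so it costs no
    layer. *)
Lemma wiring_computable w d I J K (f : rvec R J -> rvec R K) (v : rvec R I -> rvec R J) :
  wiring v -> computable w d f -> computable w d (f \o v).
Proof.
elim: d => [|d IH] in K f * => /= vW; first exact: wiring_comp.
case=> [H|[I1 [I2 [h [g [v' [H1 H2 H3 H4]]]]]]]; first by left; apply: IH.
right; exists I1, I2, (h \o v), g, v'; split=> //; first exact: IH.
by move=> x /=; rewrite H4.
Qed.

Lemma computable_comp w d d' I J K (f : rvec R I -> rvec R J) (g : rvec R J -> rvec R K) :
  computable w d f -> computable w d' g -> computable w (d + d') (g \o f).
Proof.
elim: d' => [|d' IH] in K g * => fC; first by rewrite addn0; exact: computable_wiring.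
rewrite addnS => -[H|[I1 [I2 [h [g' [v' [H1 H2 H3 H4]]]]]]]; first by left; apply: IH.
right; exists I1, I2, (h \o f), g', v'; split=> //; first exact: IH.
by move=> x /=; rewrite H4.
Qed.

Lemma computable_layer w I J (f : rvec R I -> rvec R J) : layer w f -> computable w 1 f.
Proof.
move=> fL; right; exists I, J, id, f, id; split=> //=; exact: wiring_id.
Qed.

(** * Independent maps side by side *)

Section Parallel.
Variable Lam : finType.

Definition component (I_ : Lam -> finType) l (x : rvec R {l : Lam & I_ l}) : rvec R (I_ l) :=
  [ffun i => x (Tagged I_ i)].

Definition parallel (I_ J_ : Lam -> finType) (f : forall l, rvec R (I_ l) -> rvec R (J_ l))
    (x : rvec R {l : Lam & I_ l}) : rvec R {l : Lam & J_ l} :=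
  [ffun p => f (tag p) (component (tag p) x) (tagged p)].

Lemma component_parallel (I_ J_ : Lam -> finType)
    (f : forall l, rvec R (I_ l) -> rvec R (J_ l)) l x :
  component l (parallel f x) = f l (component l x).
Proof. by apply/ffunP => j; rewrite !ffunE. Qed.

Lemma wiring_parallel (I_ J_ : Lam -> finType) (f : forall l, rvec R (I_ l) -> rvec R (J_ l)) :
  (forall l, wiring (f l)) -> wiring (parallel f).
Proof.
(* [cid] turns the existential data into sigma types, so that [all_tag] and [all_sig] can choose
   them for all [l] at once. *)
move=> fW; have /all_tag[s /all_sig[e H]] : forall l, {s : I_ l -> J_ l & {e : I_ l -> bool |
    injective s /\ forall x : rvec R (I_ l),
      (forall i, f l x (s i) = (-1) ^+ e i * x i) /\
      (forall j, j \notin codom s -> f l x j = 0)}}.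
  by move=> l; have [s /cid[e H]] := cid (fW l); exists s, e.
exists (fun p => Tagged J_ (s (tag p) (tagged p))), (fun p => e (tag p) (tagged p)).
split=> [[l i] [l' i'] /= E|x].
  have ll := congr1 tag E; rewrite /= in ll; case: _ / ll i' E => i' /eqP.
  by rewrite eq_Tagged => /eqP /(H l).1 ->.
split=> [[l i]|[l j] jn].
  by rewrite ffunE /= ((H l).2 _).1 ffunE.
rewrite ffunE /= ((H l).2 _).2 //; apply: contra jn => /codomP[i ->].
by apply/codomP; exists (Tagged I_ i).
Qed.

Lemma layer_parallel w (I_ J_ : Lam -> finType) (f : forall l, rvec R (I_ l) -> rvec R (J_ l)) :
  (forall l, layer w (f l)) -> layer w (parallel f).
Proof.
move=> fL; split=> [a x y|].
  apply/ffunP => -[l j]; rewrite !ffunE /=.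
  have -> : component l (a *: x + y) = a *: component l x + component l y.
    by apply/ffunP => i; rewrite !ffunE.
  by rewrite (fL l).1 !ffunE.
have /all_tag[B /all_tag[inb /all_sig[outb H]]] : forall l, {B : finType & {inb : I_ l -> B &
    {outb : J_ l -> B |
    (forall (x y : rvec R (I_ l)) j,
        (forall i, inb i = outb j -> x i = y i) -> f l x j = f l y j) /\
    (forall c : B, maxn #|[set i | inb i == c]| #|[set j | outb j == c]| <= w)%N}}}.
  move=> l; have [B /cid[inb /cid[outb H]]] := cid (fL l).2.
  by exists B, inb, outb.
exists {l : Lam & B l}, (fun p => Tagged B (inb (tag p) (tagged p))),
  (fun p => Tagged B (outb (tag p) (tagged p))).
split=> [x y [l j] E|[l c]].
  rewrite !ffunE /=; apply: (H l).1 => i Ei; rewrite !ffunE; apply: E => /=.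
  by rewrite Ei.
by rewrite !card_fiber_tagged; apply: (H l).2.
Qed.

(** The branches run in lockstep: their last layers together form one layer, whose blocks are those
    of the branches, so neither depth nor width adds up. *)
Lemma computable_parallel w d (I_ J_ : Lam -> finType)
    (f : forall l, rvec R (I_ l) -> rvec R (J_ l)) :
  (0 < w)%N -> (forall l, computable w d (f l)) -> computable w d (parallel f).
Proof.
move=> w0; elim: d => [|d IH] in J_ f *; first exact: wiring_parallel.
move=> fC; have /all_tag[K /all_tag[K' /all_tag[h /all_tag[g /all_sig[v H]]]]] :
    forall l, {K : finType & {K' : finType & {h : rvec R (I_ l) -> rvec R K &
      {g : rvec R K -> rvec R K' & {v : rvec R K' -> rvec R (J_ l) |
      [/\ computable w d h, layer w g, wiring v & f l =1 v \o g \o h]}}}}}.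
  move=> l; have : exists (K K' : finType) (h : rvec R (I_ l) -> rvec R K)
      (g : rvec R K -> rvec R K') (v : rvec R K' -> rvec R (J_ l)),
      [/\ computable w d h, layer w g, wiring v & f l =1 v \o g \o h].
    (* A branch with depth to spare receives an identity layer. *)
    case: (fC l) => [H|//]; exists (J_ l), (J_ l), (f l), id, id.
    by split=> //; [exact: layer_id|exact: wiring_id].
  by case/cid=> K /cid[K' /cid[h /cid[g /cid[v H]]]]; exists K, K', h, g, v.
right; exists {l : Lam & K l}, {l : Lam & K' l}, (parallel h), (parallel g), (parallel v).
split=> [||| x].
- by apply: IH => l; case: (H l).
- by apply: layer_parallel => l; case: (H l).
- by apply: wiring_parallel => l; case: (H l).
apply/ffunP => -[l j]; rewrite /= [LHS]ffunE [RHS]ffunE /= !component_parallel.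
by case: (H l) => _ _ _ ->.
Qed.

End Parallel.

(** * Real-linear maps between complex vectors *)

Section ComplexMaps.

Definition complex_of I (x : rvec R (I * bool)%type) : I -> R[i] :=
  fun i => x (i, false) +i* x (i, true).

Definition real_of I (z : I -> R[i]) : rvec R (I * bool)%type :=
  [ffun p => if p.2 then complex.Im (z p.1) else complex.Re (z p.1)].

Lemma real_ofK I (z : I -> R[i]) : complex_of (real_of z) = z.
Proof. by apply/funext => i; rewrite /complex_of !ffunE; case: (z i). Qed.

Lemma complex_ofK I (x : rvec R (I * bool)%type) : real_of (complex_of x) = x.
Proof. by apply/ffunP => -[i []]; rewrite ffunE. Qed.

Definition realify I J (F : (I -> R[i]) -> J -> R[i]) :
    rvec R (I * bool)%type -> rvec R (J * bool)%type :=
  fun x => real_of (F (complex_of x)).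

Lemma realifyE I J (F : (I -> R[i]) -> J -> R[i]) z : realify F (real_of z) = real_of (F z).
Proof. by rewrite /realify real_ofK. Qed.

Definition ccomputable w d I J (F : (I -> R[i]) -> J -> R[i]) := computable w d (realify F).

Lemma ccomputable_comp w d d' I J K (F : (I -> R[i]) -> J -> R[i])
    (G : (J -> R[i]) -> K -> R[i]) :
  ccomputable w d F -> ccomputable w d' G -> ccomputable w (d + d') (G \o F).
Proof.
move=> FC GC; apply: computable_ext (computable_comp FC GC) => x /=.
by rewrite /realify real_ofK.
Qed.

Lemma ccomputable_permute w I J (t : J -> I) :
  bijective t -> ccomputable w 0 (fun z : I -> R[i] => z \o t).
Proof.
case=> s ts st.
pose t' (p : J * bool) := (t p.1, p.2).
have t'B : bijective t' by exists (fun p => (s p.1, p.2)) => -[i e] /=; rewrite /t' /= ?ts ?st.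
apply: wiring_ext (wiring_permute t'B) => x; apply/ffunP => -[j e]; rewrite !ffunE /=.
by case: e.
Qed.

(** Only real scalars are taken out, because the coupling stages conjugate and take real parts. *)
Definition real_linear I J (F : (I -> R[i]) -> J -> R[i]) :=
  forall (a : R) x y j, F (fun i => a%:C * x i + y i) j = a%:C * F x j + F y j.

(** The real and imaginary parts of an entry go to the same block, whence the factors 2. *)
Lemma ccomputable_layer w I J (B : finType) (F : (I -> R[i]) -> J -> R[i])
    (inb : I -> B) (outb : J -> B) :
  real_linear F ->
  (forall x y j, (forall i, inb i = outb j -> x i = y i) -> F x j = F y j) ->
  (forall c, 2 * #|[set i | inb i == c]| <= w)%N ->
  (forall c, 2 * #|[set j | outb j == c]| <= w)%N ->
  ccomputable w 1 F.
Proof.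
move=> Flin Floc inw outw; apply: computable_layer; split=> [a x y|].
  have dec : complex_of (a *: x + y) = fun i => a%:C * complex_of x i + complex_of y i.
    by apply/funext => i; rewrite /complex_of !ffunE /=; simpc.
  apply/ffunP => -[j e]; rewrite !ffunE /= dec Flin.
  by case: e; case: (F _ j) => ? ?; case: (F _ j) => ? ? /=; rewrite !mul0r ?subr0 ?addr0.
exists B, (inb \o fst), (outb \o fst); split=> [x y [j e] E|c].
  rewrite !ffunE /= (Floc _ (complex_of y)) // => i Ei.
  by rewrite /complex_of !E.
by rewrite geq_max !card_fiber_fst inw outw.
Qed.

Definition cparallel (Lam : finType) (I_ J_ : Lam -> finType)
    (F : forall l, (I_ l -> R[i]) -> J_ l -> R[i]) (x : {l : Lam & I_ l} -> R[i])
    (p : {l : Lam & J_ l}) : R[i] :=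
  F (tag p) (fun i => x (Tagged I_ i)) (tagged p).

Lemma ccomputable_parallel w d (Lam : finType) (I_ J_ : Lam -> finType)
    (F : forall l, (I_ l -> R[i]) -> J_ l -> R[i]) :
  (0 < w)%N -> (forall l, ccomputable w d (F l)) -> ccomputable w d (cparallel F).
Proof.
move=> w0 FC.
(* The flag for real and imaginary parts sits outside the tag, but [parallel] needs it inside;
   regrouping is a bijection, hence wiring. *)
pose assoc (K_ : Lam -> finType) (p : {l : Lam & K_ l} * bool) :=
  Tagged (fun l => K_ l * bool)%type (tagged p.1, p.2).
pose cossa (K_ : Lam -> finType) (p : {l : Lam & (K_ l * bool)%type}) :=
  (Tagged K_ (tagged p).1, (tagged p).2).
have assocK (K_ : Lam -> finType) : cancel (assoc K_) (cossa K_) by case=> [[]].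
have cossaK (K_ : Lam -> finType) : cancel (cossa K_) (assoc K_) by case=> l [].
have W := wiring_permute (Bijective (cossaK I_) (assocK I_)).
have W' := wiring_permute (Bijective (assocK J_) (cossaK J_)).
apply: computable_ext (computable_wiring (wiring_computable W (computable_parallel w0 FC)) W').
move=> x; apply/ffunP => -[[l j] e]; rewrite !ffunE /= /cparallel /=.
suff -> : complex_of (component l (permute (cossa I_) x))
  = fun i => complex_of x (Tagged I_ i) by [].
by apply/funext => i; rewrite /complex_of !ffunE.
Qed.

End ComplexMaps.

(** * Mixed-radix Fourier transforms *)

Section DFT.

Definition dft n (z : R[i]) (x : 'I_n -> R[i]) (k : 'I_n) : R[i] :=
  \sum_(j < n) z ^+ (k * j) * x j.

(* For n = p m, the first layer gathers, for each k1 < p, the residue classes of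
   j modulo m; the transforms of length m with root z^p then remain. *)
Lemma ccomputable_dft r w n d (z : R[i]) :
  (2 * r <= w)%N -> is_product r n d -> z ^+ n = 1 -> ccomputable w d (@dft n z).
Proof.
move=> rw [s [<- sr sn]]; elim: s => [|p s IH] in n z sr sn * => zn.
  (* The empty product gives n = 1, and the transform of length 1 is the identity. *)
  rewrite big_nil in sn; case: _ / sn zn => _; apply: wiring_id => x.
  rewrite /realify (_ : dft _ _ = complex_of x) ?complex_ofK //.
  by apply/funext => k; rewrite /dft big_ord1 muln0 expr0 mul1r [k]ord1.
rewrite big_cons in sn; move: sr => /= /andP[/andP[p2 pr] sr].
set m := (\prod_(j <- s) j)%N in sn.
have m0 : (0 < m)%N.
  rewrite /m; elim: (s) sr => [|q t IHt] /=; first by rewrite big_nil.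
  by rewrite big_cons muln_gt0 => /andP[/andP[q2 _] /IHt ->]; lia.
have p0 : (0 < p)%N by lia.
have w0 : (0 < w)%N by lia.
have zpm : (z ^+ p) ^+ m = 1 by rewrite -exprM sn.
have {}IH := IH m (z ^+ p) sr (erefl _) zpm.
pose res (j : 'I_n) : 'I_m := Ordinal (ltn_pmod j m0).
(* With j = e + m t, the power z^(k1 j) contains the twiddle factor z^(k1 e) besides the short
   transform over t, so twiddles need no layer of their own. *)
pose butterfly (x : 'I_n -> R[i]) (q : {k1 : 'I_p & 'I_m}) : R[i] :=
  \sum_(j | res j == tagged q) z ^+ (tag q * j) * x j.
have bC : ccomputable w 1 butterfly.
  apply: (@ccomputable_layer w _ _ _ butterfly res (fun q => tagged q)).
  - move=> a x y q; rewrite mulr_sumr -big_split /=; apply: eq_bigr => j _; ring.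
  - by move=> x y q E; apply: eq_bigr => j /eqP /E ->.
  - move=> c; apply: leq_trans rw; rewrite leq_mul2l /=; apply: leq_trans pr.
    rewrite -[p in (_ <= p)%N]card_ord.
    (* Within a residue class modulo m, an index is determined by its quotient by m, which is below
       p. *)
    have dlt (j : 'I_n) : (j %/ m < p)%N by rewrite ltn_divLR // sn.
    rewrite -(@card_in_imset _ _ (fun j : 'I_n => Ordinal (dlt j))) ?max_card //.
    move=> j j'; rewrite !inE => /eqP ej /eqP ej' /(congr1 val) /= E.
    apply: val_inj => /=; rewrite (divn_eq j m) (divn_eq j' m) E.
    by congr (_ + _)%N; move: (etrans ej (esym ej')) => /(congr1 val).
  - move=> c; apply: leq_trans rw; rewrite leq_mul2l /=; apply: leq_trans pr.
    rewrite -[p in (_ <= p)%N]card_ord.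
    rewrite -(@card_in_imset _ _ (fun q : {k1 : 'I_p & 'I_m} => tag q)) ?max_card //.
    by move=> [a e] [a' e']; rewrite !inE /= => /eqP -> /eqP -> ->.
have kp (k : 'I_n) : (k %% p < p)%N by rewrite ltn_pmod.
have km (k : 'I_n) : (k %/ p < m)%N by rewrite ltn_divLR // mulnC sn.
have pk (q : {k1 : 'I_p & 'I_m}) : (tag q + p * tagged q < n)%N.
  by rewrite -sn; have := ltn_ord (tag q); have := ltn_ord (tagged q); nia.
(* Frequencies are read as k = k1 + p k2, while inputs are split modulo m; the reordering is left to
   wiring. *)
pose digits (k : 'I_n) : {k1 : 'I_p & 'I_m} :=
  Tagged (fun=> 'I_m) (i := Ordinal (kp k)) (Ordinal (km k)).
have digitsB : bijective digits.
  exists (fun q => Ordinal (pk q)) => [k|[a e]].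
    by apply: val_inj; rewrite /= mulnC addnC -divn_eq.
  rewrite /digits; set a' := Ordinal _; set e' := Ordinal _.
  have -> : a' = a by apply: val_inj; rewrite /= addnC mulnC modnMDl modn_small.
  suff -> : e' = e by [].
  by apply: val_inj; rewrite /= addnC mulnC divnMDl // divn_small // addn0.
have C := ccomputable_comp bC (ccomputable_parallel w0 (fun _ : 'I_p => IH)).
have {C} := ccomputable_comp C (ccomputable_permute w digitsB).
rewrite addn0 /=; apply: computable_ext => x; congr real_of; apply/funext => k /=.
rewrite /cparallel /dft /=.
under eq_bigr do rewrite mulr_sumr.
rewrite [RHS](partition_big res predT) //=; apply: eq_bigr => e _.
apply: eq_bigr => j /eqP <- /=; rewrite mulrA; congr (_ * _).
(* Since (z^p)^m = 1, the residue of j modulo m may be replaced by j in the exponent; then k1 + p k2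
   = k. *)
rewrite exprM expr_mod; last by rewrite exprAC zpm expr1n.
by rewrite -!exprM -exprD ?mulnA -mulnDl [in RHS](divn_eq k p) (mulnC p).
Qed.

End DFT.
End Calculus.

(** * Roots of unity and the inverse Fourier matrix *)

Section FourierRoot.
Variable R : realType.

Lemma cisD (s t : R) : cis (s + t) = cis s * cis t.
Proof. by rewrite /cis cosD sinD; simpc; congr (_ +i* _); ring. Qed.

Lemma cis0 : cis 0 = 1 :> R[i].
Proof. by rewrite /cis cos0 sin0. Qed.

Lemma cisMn (t : R) n : cis (t * n%:R) = cis t ^+ n.
Proof.
elim: n => [|n IH]; first by rewrite mulr0 cis0.
by rewrite exprSr -IH -cisD -natr1 mulrDr mulr1.
Qed.

Lemma cis_mul_conj (t : R) : cis t * conjc (cis t) = 1.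
Proof.
rewrite /cis /=; simpc; apply/eqP; rewrite eq_complex /=.
by apply/andP; split; apply/eqP; rewrite -?[1](cos2Dsin2 t); ring.
Qed.

Definition fourier_root n : R[i] := cis (- (2 * pi / n%:R)).

Lemma fourierE n (k j : 'I_n) : fourier R n k j = fourier_root n ^+ (k * j).
Proof. by rewrite mxE -cisMn; congr cis; ring. Qed.

Lemma fourier_root_unity n : (0 < n)%N -> fourier_root n ^+ n = 1.
Proof.
move=> n0; rewrite -cisMn mulNr mulrVK ?unitfE ?pnatr_eq0 -?lt0n //.
by have := cis_periodicn (0 : R) 1; rewrite mulr1 sub0r cis0.
Qed.

(** For 0 < k < n the real part of the k-th power is cos(2t) = 1 - 2 sin^2 t with t = pi k / n in
    (0, pi), hence is not 1. *)
Lemma fourier_root_prim n : (0 < n)%N -> n.-primitive_root (fourier_root n).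
Proof.
move=> n0; apply/andP; split=> //; apply/forallP => i; rewrite unity_rootE.
have [->|ni] := eqVneq i.+1 n; first by rewrite fourier_root_unity ?eqxx.
apply/eqP/negP => /eqP; rewrite -cisMn => -[/eqP + _].
have n0' : 0 < n%:R :> R by rewrite ltr0n.
have pi0 : 0 < (pi : R) := pi_gt0 R.
pose t : R := pi / n%:R * i.+1%:R.
have -> : - (2 * pi / n%:R) * i.+1%:R = - (t *+ 2) by rewrite /t; ring.
rewrite cosN cos_mulr2n cos2sin2 => E.
have : 0 < sin t.
  apply: sin_gt0_pi; rewrite /t mulr_gt0 ?divr_gt0 ?ltr0n //=.
  rewrite mulrAC ltr_pdivrMr // ltr_pM2l // ltr_nat.
  by have := ltn_ord i; lia.
move=> /lt0r_neq0 /eqP; apply; apply/eqP; rewrite -sqrf_eq0; apply/eqP; move/eqP: E.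
lra.
Qed.

Lemma fourier_root_neq0 n : fourier_root n != 0.
Proof.
apply/eqP => w0; have /eqP := cis_mul_conj (- (2 * pi / n%:R) : R).
by rewrite -/(fourier_root n) w0 mul0r eq_sym oner_eq0.
Qed.

Lemma fourier_root_conj n : conjc (fourier_root n) = (fourier_root n)^-1.
Proof.
apply: (mulfI (fourier_root_neq0 n)); rewrite divff ?fourier_root_neq0 //.
exact: cis_mul_conj.
Qed.

(** The claimed matrix is a right inverse: off the diagonal, the product consists of geometric sums
    with ratio u != 1 and u^n = 1. *)
Lemma invmx_fourierE n (k j : 'I_n) :
  invmx (fourier R n) k j = n%:R^-1 * (fourier_root n)^-1 ^+ (k * j).
Proof.
have n0 : (0 < n)%N by apply: leq_ltn_trans (ltn_ord k).
have w0 := fourier_root_neq0 n.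
pose G := \matrix_(k < n, j < n) (n%:R^-1 * (fourier_root n)^-1 ^+ (k * j)).
suff FG : fourier R n *m G = 1%:M.
  have Fu := mulmx1_unit FG; rewrite -[invmx _]mulmx1 -FG mulKmx ?mxE //; exact: Fu.1.
apply/matrixP => a c; rewrite !mxE.
pose u := fourier_root n ^+ a / fourier_root n ^+ c.
transitivity (n%:R^-1 * \sum_(i < n) u ^+ i).
  rewrite mulr_sumr; apply: eq_bigr => i _; rewrite fourierE mxE mulrCA; congr (_ * _).
  by rewrite /u -exprVn exprMn -!exprM (mulnC i).
have [ac|ac] := eqVneq a c.
  rewrite /u ac divff ?expf_neq0 //; under eq_bigr do rewrite expr1n.
  by rewrite sumr_const card_ord mulVf ?pnatr_eq0 -?lt0n.
have u1 : u != 1.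
  apply: (contraNneq _ ac) => E; have : fourier_root n ^+ a = fourier_root n ^+ c.
    by rewrite -[LHS](divfK (expf_neq0 c w0)) -/u E mul1r.
  by move/eqP; rewrite (eq_prim_root_expr (fourier_root_prim n0)) !modn_small.
have := subrX1 u n.
rewrite {1}/u exprMn exprVn !(exprAC _ _ n) fourier_root_unity // !expr1n divr1 subrr.
by move/esym/eqP; rewrite mulf_eq0 subr_eq0 (negbTE u1) /= => /eqP ->; rewrite mulr0.
Qed.

End FourierRoot.

(** * Packing two real samples into one complex number *)

Section Packing.
Variables (R : realType) (L : nat).
Hypothesis L_gt0 : (0 < L)%N.

Definition residue (k : nat) : 'I_L := Ordinal (ltn_pmod k L_gt0).

Lemma dft_residue (z : R[i]) (x : 'I_L -> R[i]) k : z ^+ L = 1 ->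
  dft z x (residue k) = \sum_(j < L) z ^+ (k * j) * x j.
Proof.
move=> zL; apply: eq_bigr => j _; congr (_ * _).
by rewrite mulnC exprM /= expr_mod -?exprM 1?mulnC // exprM zL expr1n.
Qed.

(** As z has modulus 1, conjugation inverts it and so turns the frequency -k into k. The
    representative L - k %% L is L itself when L divides k; [residue] reduces it to 0. *)
Lemma conj_dft_residue (z : R[i]) (x : 'I_L -> R[i]) k : z ^+ L = 1 -> z * conjc z = 1 ->
  conjc (dft z x (residue (L - k %% L))) = \sum_(j < L) z ^+ (k * j) * conjc (x j).
Proof.
move=> zL zz; rewrite dft_residue // rmorph_sum; apply: eq_bigr => j _ /=.
rewrite rmorphM rmorphXn /=; congr (_ * _); rewrite !exprM; congr (_ ^+ _).
have zk : z ^+ (k %% L) = z ^+ k by rewrite expr_mod.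
have z0 : z ^+ (L - k %% L) != 0.
  rewrite expf_neq0 //; apply/eqP => z0; move: zz; rewrite z0 mul0r => /eqP.
  by rewrite eq_sym oner_eq0.
apply: (mulfI z0); rewrite -exprMn zz expr1n -zk -exprD subnK ?zL //.
by rewrite ltnW // ltn_pmod.
Qed.

Definition fwd_coef (v : R[i]) : R[i] := (1 - 'i * v) * (2^-1)%:C.
Definition bwd_coef (v : R[i]) : R[i] := (1 + 'i * v) * (2^-1)%:C.

(** Comes from Re z = (z + conj z)/2 and Im z = -i (z - conj z)/2. *)
Lemma unpackE (v z : R[i]) :
  fwd_coef v * z + bwd_coef v * conjc z = (complex.Re z)%:C + v * (complex.Im z)%:C.
Proof.
case: z => a c; case: v => p q; rewrite /fwd_coef /bwd_coef; simpc.
by congr (_ +i* _) => /=; field.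
Qed.

(** For z = w^2 and v = w^k the right side is the transform at bin k of the real signal with even
    samples Re x_j and odd samples Im x_j. *)
Lemma dft_unpack (z v : R[i]) (x : 'I_L -> R[i]) k : z ^+ L = 1 -> z * conjc z = 1 ->
  fwd_coef v * dft z x (residue k) + bwd_coef v * conjc (dft z x (residue (L - k %% L)))
  = \sum_(j < L) z ^+ (k * j) * ((complex.Re (x j))%:C + v * (complex.Im (x j))%:C).
Proof.
move=> zL zz; rewrite conj_dft_residue // dft_residue // !mulr_sumr -big_split /=.
by apply: eq_bigr => j _; rewrite -unpackE; ring.
Qed.

Lemma fold_subproof k : (minn (k %% L) (L - k %% L) < L)%N.
Proof. by rewrite gtn_min ltn_pmod. Qed.

(* The representative of the unordered pair {k, -k} of residues modulo L. *)
Definition fold (k : nat) : 'I_L := Ordinal (fold_subproof k).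

Lemma eq_fold k k' : (k = k' %[mod L])%N -> fold k = fold k'.
Proof. by move=> E; apply: val_inj; rewrite /= E. Qed.

Lemma foldN k k' : (L %| k + k')%N -> fold k = fold k'.
Proof.
move=> d; apply: val_inj => /=; have := ltn_pmod k L_gt0; have := ltn_pmod k' L_gt0.
have : (L %| k %% L + k' %% L)%N by rewrite /dvdn modnDm.
(* Both residues are below L, so their sum is 0 or L. *)
move: (k %% L)%N (k' %% L)%N => a a' /dvdnP[[|[|e]] E] *; lia.
Qed.

(** Ties the blocks to the disjunction that defines [fan_out_at]. *)
Lemma foldP k (q : 'I_L) : fold k = q -> (k == q %[mod L]) || (k + q == 0 %[mod L]).
Proof.
move=> /(congr1 val) /=; have := ltn_pmod k L_gt0.
rewrite mod0n -(modnDml k) (modn_small (ltn_ord q)); move: (k %% L)%N => a aL E.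
case: leqP E => _ E; first by rewrite -E eqxx.
by rewrite -E subnKC ?modnn ?eqxx ?orbT // ltnW.
Qed.

(** Only c and -c can occur; two complex entries account for the real width 4 in the bound. *)
Lemma card_fold (c : 'I_L) : (#|[set q : 'I_L | fold q == c]| <= 2)%N.
Proof.
have /subset_leq_card /leq_trans -> // :
    [set q : 'I_L | fold q == c] \subset [set c; residue (L - c)].
  apply/subsetP => q; rewrite !inE => /eqP /foldP.
  rewrite (modn_small (ltn_ord q)) (modn_small (ltn_ord c)) mod0n.
  case/orP => [/eqP/val_inj ->|]; first by rewrite eqxx.
  move=> d; apply/orP; right; apply/eqP/val_inj => /=.
  have := ltn_ord q; have := ltn_ord c; case/dvdnP: d => [[|[|e]] E] *; last by lia.
    have [-> ->] : q = 0 :> nat /\ c = 0 :> nat by lia.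
    by rewrite subn0 modnn.
  by rewrite modn_small; lia.
by rewrite cards2; case: eqP.
Qed.

End Packing.

(** * Minimal factorizations *)

Lemma is_product_tau r n : factorable r n -> is_product r n (tau r n).
Proof.
(* Factorability rules out the branch in which [tau] takes its default value 0. *)
rewrite /tau => -[d nd]; case: pselect => [ex|[]]; last by exists d; apply/asboolP.
by case: ex_minnP => m /asboolP.
Qed.

(** Supplies the positivity of L and of the band lengths, on which the root-of-unity identities
    rest. *)
Lemma factorable_gt0 r n : factorable r n -> (0 < n)%N.
Proof.
case=> d [s [_ sr <-]]; elim: s sr => [|m s IH] /=; first by rewrite big_nil.
by case/andP=> /andP[m2 _] /IH; rewrite big_cons muln_gt0 => ->; rewrite andbT; lia.
Qed.

Lemma conjc_real_linear (R : rcfType) (a : R) (u v : R[i]) :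
  conjc (a%:C * u + v) = a%:C * conjc u + conjc v.
Proof. by case: u v => [? ?] [? ?]; simpc. Qed.

(** * Even and odd samples *)

Section Signal.
Variable N : nat.
Hypothesis N_even : ~~ odd N.

Lemma evenE : N = N./2.*2.
Proof. by rewrite -[LHS]odd_double_half (negbTE N_even). Qed.

Lemma join_subproof (p : 'I_N./2 * bool) : (p.1.*2 + p.2 < N)%N.
Proof. by have := ltn_ord p.1; have := evenE; case: p.2; lia. Qed.

(** The flag is the parity. As [real_of] marks imaginary parts by [true], packing a signal merely
    permutes real coordinates. *)
Definition join_index (p : 'I_N./2 * bool) : 'I_N := Ordinal (join_subproof p).

Lemma split_subproof (k : 'I_N) : (k./2 < N./2)%N.
Proof. by have := ltn_ord k; have := evenE; lia. Qed.

Definition split_index (k : 'I_N) : 'I_N./2 * bool := (Ordinal (split_subproof k), odd k).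

Lemma join_indexK : cancel join_index split_index.
Proof.
case=> j e; rewrite /split_index /=; congr (_, _); first apply: val_inj => /=.
  by rewrite addnC half_bit_double.
by rewrite oddD odd_double; case: e.
Qed.

Lemma split_indexK : cancel split_index join_index.
Proof. by move=> k; apply: val_inj; rewrite /= addnC odd_double_half. Qed.

Lemma sum_join (V : nmodType) (f : 'I_N -> V) :
  \sum_k f k = \sum_j (f (join_index (j, false)) + f (join_index (j, true))).
Proof.
rewrite (reindex join_index) /=; last first.
  by exists split_index => ? _; rewrite ?join_indexK ?split_indexK.
rewrite (eq_bigr (fun p => f (join_index (p.1, p.2)))) => [|[] //].
rewrite -(pair_bigA _ (fun j e => f (join_index (j, e)))) /=; apply: eq_bigr => j _.
by rewrite big_bool addrC.
Qed.

End Signal.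

(** * The stages that couple residues with band entries *)

Section Bands.
Variables (R : realType) (N : nat) (Lam : finType) (b : Lam -> band R N).
Hypothesis N_even : ~~ odd N.
Hypothesis b_painless : painless b.
Hypothesis L_gt0 : (0 < N./2)%N.

Local Notation L := N./2.
Local Notation entry := {l : Lam & 'I_(blen (b l))}.
Local Notation w := (fourier_root R N).

(** Makes [entry_block] independent of the bin that [pick] returns; injectivity of the slot maps
    enters here. *)
Lemma holds_inj l (m : 'I_(blen (b l))) k k' : holds m k -> holds m k' -> k = k'.
Proof.
move=> /existsP[u /andP[/eqP <- /eqP um]] /existsP[v /andP[/eqP <- /eqP vm]].
by have /b_painless.1 -> : slot (b l) u = slot (b l) v by rewrite um.
Qed.

(* An entry that holds no bin forms a block of its own. *)
Definition entry_block (p : entry) : 'I_L + entry :=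
  if [pick k | holds (tagged p) k] is Some k then inl (fold L_gt0 k) else inr p.

Definition residue_block (q : 'I_L) : 'I_L + entry := inl (fold L_gt0 q).

Lemma entry_blockE (p : entry) k : holds (tagged p) k -> entry_block p = inl (fold L_gt0 k).
Proof.
rewrite /entry_block; case: pickP => [k' h' h|-> //].
by rewrite (holds_inj h' h).
Qed.

Lemma card_entry_block c :
  (2 * #|[set p | entry_block p == c]| <= maxn 4 (2 * fan_out b))%N.
Proof.
rewrite leq_max; apply/orP; case: c => [q|p0].
  right; rewrite leq_mul2l /=.
  apply: leq_trans (leq_bigmax (F := fun q : 'I_L => fan_out_at b q) q).
  apply/subset_leq_card/subsetP => p; rewrite !inE /entry_block.
  case: pickP => [k hk|//] /eqP[/foldP kq].
  by apply/existsP; exists k; rewrite hk.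
(* The block of an entry without a bin is a singleton, of real width 2. *)
left; rewrite (_ : 4 = 2 * 2)%N // leq_mul2l /=.
apply: (@leq_trans #|[set p0]|); last by rewrite cards1.
apply/subset_leq_card/subsetP => p; rewrite !inE /entry_block.
by case: pickP => // _ /eqP[->].
Qed.

Lemma card_residue_block c :
  (2 * #|[set q | residue_block q == c]| <= maxn 4 (2 * fan_out b))%N.
Proof.
rewrite leq_max; apply/orP; left; rewrite (_ : 4 = 2 * 2)%N // leq_mul2l /=.
case: c => [q|p]; first exact: (card_fold L_gt0 q).
by rewrite eq_card0 // => q; rewrite !inE.
Qed.

Lemma residue_block_mod k : residue_block (residue L_gt0 k) = inl (fold L_gt0 k).
Proof. by congr inl; apply: eq_fold; rewrite /= modn_mod. Qed.

Lemma residue_block_opp k :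
  residue_block (residue L_gt0 (L - k %% L)) = inl (fold L_gt0 k).
Proof.
congr inl; apply: foldN; rewrite /dvdn /= modnDml -modnDmr subnK ?modnn //.
by rewrite ltnW // ltn_pmod.
Qed.

Lemma root_unity_half : (w ^+ 2) ^+ L = 1.
Proof.
rewrite -exprM mul2n -evenE // fourier_root_unity //.
by have := evenE N_even; lia.
Qed.

Lemma root_mul_conj n : fourier_root R n * conjc (fourier_root R n) = 1.
Proof. by rewrite fourier_root_conj divff ?fourier_root_neq0. Qed.

(* The factor 1/M of the inverse transform of a band is absorbed here. *)
Definition analysis_stage (z : 'I_L -> R[i]) (p : entry) : R[i] :=
  \sum_(k | holds (tagged p) k)
    ((blen (b (tag p)))%:R^-1 * window (b (tag p)) 0 k)%:C *
    (fwd_coef (w ^+ k) * z (residue L_gt0 k) +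
     bwd_coef (w ^+ k) * conjc (z (residue L_gt0 (L - k %% L)))).

Lemma ccomputable_analysis_stage width : (maxn 4 (2 * fan_out b) <= width)%N ->
  ccomputable width 1 analysis_stage.
Proof.
move=> ww; apply: (@ccomputable_layer _ _ _ _ _ analysis_stage residue_block entry_block).
- move=> a x y p; rewrite mulr_sumr -big_split /=; apply: eq_bigr => k _.
  by rewrite conjc_real_linear; ring.
- move=> x y p E; apply: eq_bigr => k hk.
  rewrite !E // (entry_blockE hk); [exact: residue_block_opp|exact: residue_block_mod].
- by move=> c; apply: leq_trans ww; apply: card_residue_block.
- by move=> c; apply: leq_trans ww; apply: card_entry_block.
Qed.

Definition pack (x : 'cV[R]_N) (j : 'I_L) : R[i] :=
  x (join_index N_even (j, false)) 0 +i* x (join_index N_even (j, true)) 0.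

(** Split by parity, sample 2j has the factor (w^2)^(kj), and sample 2j+1 has an additional w^k. *)
Lemma fourier_signal (x : 'cV[R]_N) (k : 'I_N) :
  (fourier R N *m mxC x) k 0 =
    fwd_coef (w ^+ k) * dft (w ^+ 2) (pack x) (residue L_gt0 k) +
    bwd_coef (w ^+ k) * conjc (dft (w ^+ 2) (pack x) (residue L_gt0 (L - k %% L))).
Proof.
rewrite dft_unpack; first last.
- by rewrite rmorphXn /= -exprMn root_mul_conj expr1n.
- exact: root_unity_half.
rewrite mxE (sum_join N_even); apply: eq_bigr => j _.
rewrite !fourierE !mxE /= -exprM addn0 addn1 mulnS exprD -!muln2 (mulnC j) !mulnA (mulnC k 2).
by rewrite mulrDr !mulrA (mulrC (w ^+ k)).
Qed.

Lemma analysisE (x : 'cV[R]_N) l m :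
  analysis b x l m 0 =
  cparallel (fun l => dft (fourier_root R (blen (b l)))^-1)
    (analysis_stage (dft (w ^+ 2) (pack x))) (Tagged (fun l => 'I_(blen (b l))) m).
Proof.
rewrite /analysis mxE /cparallel /dft /=; apply: eq_bigr => m' _.
rewrite invmx_fourierE mulrAC mulrC; congr (_ * _).
(* A row of the selection matrix is the indicator of the bins held, which restricts the sum over all
   bins to these. *)
rewrite -!mulmxA mxE mulr_sumr /analysis_stage [RHS]big_mkcond /=; apply: eq_bigr => k _.
rewrite [mxC (selmx _) _ _]mxE [selmx _ _ _]mxE.
case: ifP => _; last by rewrite rmorph0 mul0r mulr0.
rewrite -fourier_signal [mxC (diag_mx _)]map_diag_mx mul_diag_mx mxE [map_mx _ _ _ _]mxE.
rewrite rmorph1 mul1r.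
by rewrite rmorphM fmorphV rmorph_nat mulrA.
Qed.

(* [half_stage] and [full_stage] are [half_spectrum] and [full_spectrum] as
   functions of the transformed entries F_M c. *)
Definition half_stage (v : entry -> R[i]) (k : 'I_N) : R[i] :=
  \sum_l (dual_window b l k)%:C *
    \sum_(m : 'I_(blen (b l)) | holds m k) v (Tagged (fun l => 'I_(blen (b l))) m).

Definition full_stage (v : entry -> R[i]) (k : 'I_N) : R[i] :=
  if (val k == 0%N) || (val k == L) then (complex.Re (half_stage v k))%:C
  else if (k < L)%N then half_stage v k else conjc (half_stage v (neg_ord k)).

(** The bins q and q + L meet here, together with the factor 1/N of the inverse transform. *)
Definition synthesis_stage (v : entry -> R[i]) (q : 'I_L) : R[i] :=
  \sum_(k : 'I_N | residue L_gt0 k == q) N%:R^-1 * (1 + 'i * w^-1 ^+ k) * full_stage v k.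

Lemma half_stage_linear (a : R) (x y : entry -> R[i]) k :
  half_stage (fun p => a%:C * x p + y p) k = a%:C * half_stage x k + half_stage y k.
Proof.
rewrite /half_stage [in RHS]mulr_sumr -big_split /=; apply: eq_bigr => l _.
by rewrite mulrCA -mulrDr; congr (_ * _); rewrite mulr_sumr -big_split.
Qed.

Lemma full_stage_linear (a : R) (x y : entry -> R[i]) k :
  full_stage (fun p => a%:C * x p + y p) k = a%:C * full_stage x k + full_stage y k.
Proof.
rewrite /full_stage !half_stage_linear; case: ifP => _.
  by case: (half_stage x k) => ? ?; case: (half_stage y k) => ? ? /=; simpc.
by case: ifP => _ //; rewrite conjc_real_linear.
Qed.

Lemma eq_half_stage (x y : entry -> R[i]) (k : 'I_N) :
  (forall p, entry_block p = inl (fold L_gt0 k) -> x p = y p) -> half_stage x k = half_stage y k.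
Proof.
move=> E; apply: eq_bigr => l _; congr (_ * _); apply: eq_bigr => m hm.
by apply: E; apply: entry_blockE.
Qed.

(** Since L divides N, negation modulo N induces negation modulo L. Bins above L, obtained by
    conjugating the mirrored bin, thus read only their own block. *)
Lemma fold_neg_ord (k : 'I_N) : fold L_gt0 (neg_ord k) = fold L_gt0 k.
Proof.
apply: foldN => /=; have LN : (L %| N)%N by rewrite [X in (_ %| X)%N]evenE // -muln2 dvdn_mulr.
by rewrite /dvdn -modnDml modn_dvdm // modnDml subnK // ltnW.
Qed.

Lemma eq_full_stage (x y : entry -> R[i]) (k : 'I_N) :
  (forall p, entry_block p = inl (fold L_gt0 k) -> x p = y p) -> full_stage x k = full_stage y k.
Proof.
move=> E; rewrite /full_stage (eq_half_stage E).
by rewrite (@eq_half_stage x y (neg_ord k)) // fold_neg_ord.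
Qed.

Lemma ccomputable_synthesis_stage width : (maxn 4 (2 * fan_out b) <= width)%N ->
  ccomputable width 1 synthesis_stage.
Proof.
move=> ww; apply: (@ccomputable_layer _ _ _ _ _ synthesis_stage entry_block residue_block).
- move=> a x y q; rewrite mulr_sumr -big_split /=; apply: eq_bigr => k _.
  by rewrite full_stage_linear; ring.
- move=> x y q E; apply: eq_bigr => k /eqP kq; congr (_ * _); apply: eq_full_stage => p Ep.
  by apply: E; rewrite Ep -kq residue_block_mod.
- by move=> c; apply: leq_trans ww; apply: card_entry_block.
- by move=> c; apply: leq_trans ww; apply: card_residue_block.
Qed.

Definition band_spectrum (c : coeffs b) (p : entry) : R[i] :=
  (fourier R (blen (b (tag p))) *m c (tag p)) (tagged p) 0.

Lemma band_spectrumE (c : coeffs b) :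
  cparallel (fun l => dft (fourier_root R (blen (b l)))) (fun p => c (tag p) (tagged p) 0)
  = band_spectrum c.
Proof.
apply/funext => -[l m]; rewrite /cparallel /dft /band_spectrum /= mxE.
by apply: eq_bigr => m' _; rewrite fourierE.
Qed.

Lemma full_stageE (c : coeffs b) k : full_stage (band_spectrum c) k = full_spectrum c k 0.
Proof.
have halfE j : half_stage (band_spectrum c) j = half_spectrum c j.
  apply: eq_bigr => l _; congr (_ * _); rewrite /band_spectrum mxE [LHS]big_mkcond /=.
  apply: eq_bigr => m _; rewrite !mxE; case: ifP => _.
    by rewrite rmorph1 mul1r.
  by rewrite rmorph0 mul0r.
by rewrite /full_stage !halfE mxE.
Qed.

Lemma synthesis_pack (c : coeffs b) :
  pack (synthesis b c) =
  dft (w ^+ 2)^-1 (synthesis_stage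
    (cparallel (fun l => dft (fourier_root R (blen (b l)))) (fun p => c (tag p) (tagged p) 0))).
Proof.
apply/funext => j; rewrite /dft.
rewrite band_spectrumE.
have N0 : (0 < N)%N by have := evenE N_even; lia.
(* By [synthesisE] the inverse transform is real, so its complex sums may be combined as y_(2j) + i
   y_(2j+1). *)
have XE k : (synthesis b c k 0)%:C =
    \sum_(n < N) N%:R^-1 * w^-1 ^+ (k * n) * full_spectrum c n 0.
  have /matrixP/(_ k 0) := synthesisE c N_even; rewrite [LHS]mxE => ->.
  by rewrite mxE; apply: eq_bigr => n _; rewrite invmx_fourierE.
have -> : pack (synthesis b c) j = (synthesis b c (join_index N_even (j, false)) 0)%:C +
    'i * (synthesis b c (join_index N_even (j, true)) 0)%:C.
  by rewrite /pack; simpc.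
rewrite !XE mulr_sumr -big_split /=.
under [RHS]eq_bigr do rewrite mulr_sumr.
rewrite [LHS](partition_big (fun k : 'I_N => residue L_gt0 k) predT) //=; apply: eq_bigr => q _.
apply: eq_bigr => k /eqP <-; rewrite full_stageE -exprVn.
(* The power w^(-2jk) depends on k only modulo L, because w^(2L) = 1. *)
have -> : (w^-1 ^+ 2) ^+ (j * residue L_gt0 k) = w^-1 ^+ (j.*2 * k).
  have u1 : (w^-1 ^+ 2) ^+ L = 1 by rewrite !exprVn root_unity_half // invr1.
  by rewrite mulnC exprM /= expr_mod // -!exprM -muln2; congr (_ ^+ _); lia.
rewrite addn0 addn1 mulSn exprD; ring.
Qed.

End Bands.

(** * Assembly of the transforms and the coupling stages *)

Theorem theorem1 (R : realType) (N : nat) (Lam : finType) (b : Lam -> band R N)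
    (r : nat) (N_even : ~~ odd N) (b_painless : painless b) (r_ge2 : (2 <= r)%N)
    (L_fact : factorable r N./2) (M_fact : forall l, factorable r (blen (b l))) :
  let d := (tau r N./2 + 1 + \max_(l : Lam) tau r (blen (b l)))%N in
  let w := maxn (2 * r)%N (maxn 4 (2 * fan_out b)%N) in
  evaluated d w (@signal_coords R N) (coeff_coords b) (analysis b) /\
  evaluated d w (coeff_coords b) (@signal_coords R N) (synthesis b).
Proof.
move=> d w.
have L_gt0 := factorable_gt0 L_fact.
have rw : (2 * r <= w)%N by rewrite leq_maxl.
have ww : (maxn 4 (2 * fan_out b) <= w)%N by rewrite leq_maxr.
have w_gt0 : (0 < w)%N by lia.
have coeff_coordsE c : coeff_coords b c = real_of (fun p => c (tag p) (tagged p) 0).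
  by apply/ffunP => p; rewrite !ffunE.
have signal_dft z : z ^+ N./2 = 1 -> ccomputable w (tau r N./2) (@dft R N./2 z).
  by apply: ccomputable_dft rw _; apply: is_product_tau.
have band_dft (z : Lam -> R[i]) : (forall l, z l ^+ blen (b l) = 1) ->
    ccomputable w (\max_(l : Lam) tau r (blen (b l)))
      (cparallel (fun l => @dft R (blen (b l)) (z l))).
  move=> zM; apply: ccomputable_parallel => // l.
  (* Bands with fewer factors are padded to the maximal depth. *)
  apply: computable_leq (leq_bigmax l) _.
  by apply: (ccomputable_dft rw) (zM l); apply: is_product_tau.
have joinB := Bijective (join_indexK N_even) (split_indexK N_even).
have splitB := Bijective (split_indexK N_even) (join_indexK N_even).
have wM l := fourier_root_unity R (factorable_gt0 (M_fact l)).
have wL := root_unity_half R N_even L_gt0.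
have packE (x : 'cV[R]_N) : permute (join_index N_even) (signal_coords x) = real_of (pack N_even x).
  by apply/ffunP => -[j e]; rewrite !ffunE; case: e.
split.
- have C := ccomputable_comp (signal_dft _ wL)
    (ccomputable_analysis_stage b_painless L_gt0 ww).
  (* Inverse transforms use the inverse roots; their factor 1/M is already in [analysis_stage]. *)
  have {}C := ccomputable_comp C (band_dft (fun l => (fourier_root R (blen (b l)))^-1)
    (fun l => etrans (exprVn _ _) (etrans (congr1 GRing.inv (wM l)) (invr1 _)))).
  have {}C := wiring_computable (wiring_permute R joinB) C.
  eexists; split; first exact: C.
  move=> x; rewrite coeff_coordsE [LHS]/= packE realifyE; congr real_of; apply/funext => -[l m].
  by rewrite analysisE.
- have C := ccomputable_comp (band_dft _ wM)
    (ccomputable_synthesis_stage N_even b_painless L_gt0 ww).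
  have {}C := ccomputable_comp C (signal_dft _
    (etrans (exprVn _ _) (etrans (congr1 GRing.inv wL) (invr1 _)))).
  have {}C := computable_wiring C (wiring_permute R splitB).
  (* The stages come in reverse order, so the three depths are summed in reverse. *)
  eexists; split; first by rewrite /d addnC addnA addnAC; exact: C.
  move=> c; rewrite coeff_coordsE [LHS]/= realifyE.
  rewrite /= -(synthesis_pack N_even L_gt0) -packE.
  by apply/ffunP => k; rewrite !ffunE split_indexK.
Qed.
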